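(* Let $W$ be a Banach space and $V=W^*$; write $(V,\|\cdot\|)$ for $V$ with the norm topology and $(V,w^* )$ for $V$ with the weak$^*$ topology. Let $X$ be a connected, locally connected, Hausdorff, first countable, normal topological space and $f:X\to V$ a map such that $f:X\to(V,\|\cdot\|)$ is continuous, has local convexity data and is locally fiber connected, and $f:X\to(V,w^* )$ is closed. Then: (i) all fibers of $f$ are connected; (ii) $f:X\to(V,w^* )$ is open onto its image; (iii) the image $f(X)$ is a closed convex subset of $(V,w^* )$.
   Context: Local convexity data and local fiber connectedness are taken with respect to the norm topology of $V$. A subset $C\subset V$ is a cone with vertex $v_0$ if $v_0\in C$ and $(1-\lambda)v_0+\lambda v\in C$ for every $\lambda\ge 0$ and every $v\in C$, $v\ne v_0$; it is a convex cone if it is moreover convex. A continuous map $f:X\to V$ has local convexity data if for each $x\in X$ and every sufficiently small open neighborhood $U_x$ of $x$ there is a convex cone $C_x\subset V$ with vertex $f(x)$, endowed with the subspace topology from $V$, such that (VN) $f(U_x)\subset C_x$ and $f(U_x)$ is a neighborhood of $f(x)$ in $C_x$; and (SLO) $f|_{U_x}:U_x\to C_x$ is an open map, and for every neighborhood $U'_x\subset U_x$ of $x$ the set $f(U'_x)$ is a neighborhood of $f(x)$ in $C_x$. A subset $A\subset X$ satisfies condition (LFC) if for every $a\in A$, the set $A$ does not intersect two different connected components of the fiber $f^{-1}(f(a))$. The map $f$ is locally fiber connected if for every $x\in X$, every open neighborhood of $x$ contains a neighborhood $U_x$ of $x$ satisfying (LFC). ''Open onto its image'' means open as a map onto $f(X)$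 with the subspace topology. *)

(* Defs.v *)
From HB Require Import structures.
From mathcomp Require Import all_boot all_order all_algebra.
From mathcomp Require Import all_classical all_reals.
From mathcomp Require Import topology normedtype.
Set Implicit Arguments. Unset Strict Implicit. Unset Printing Implicit Defensive.
Import Order.TTheory GRing.Theory Num.Theory.
Import numFieldNormedType.Exports.
Local Open Scope classical_set_scope.
Local Open Scope ring_scope.

Definition locally_connected_space (T : topologicalType) :=
  forall (x : T) (U : set T), nbhs x U ->
    exists V : set T, [/\ open V, V x, connected V & V `<=` U].

Definition first_countable_space (T : topologicalType) :=
  forall x : T, exists B : nat -> set T,
    (forall n, nbhs x (B n)) /\
    (forall U, nbhs x U -> exists n, B n `<=` U).

(* Elements of V are represented as functions W -> R; [dual W] is the set of
   continuous linear functionals. *)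
Section Dual.
Context {R : realType} {W : completeNormedModType R}.

Definition dual : set (W -> R) :=
  [set phi | (forall (a : R) (u v : W), phi (a *: u + v) = a * phi u + phi v)
             /\ continuous phi].

Definition dnorm (phi : W -> R) : R :=
  sup [set `|phi w| | w in [set w : W | `|w| <= 1]].

Definition dsub (phi psi : W -> R) : W -> R := fun w => phi w - psi w.

Definition comb (t : R) (u v : W -> R) : W -> R :=
  fun w => (1 - t) * u w + t * v w.

Definition nnbhs_in (C : set (W -> R)) (v : W -> R) (A : set (W -> R)) :=
  exists2 e : R, 0 < e &
    forall psi, C psi -> dnorm (dsub psi v) < e -> A psi.

Definition nopen_in (C A : set (W -> R)) :=
  A `<=` C /\ forall v, A v -> nnbhs_in C v A.

Definition nopen (A : set (W -> R)) := nopen_in dual A.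

Definition wopen (A : set (W -> R)) :=
  A `<=` dual /\
  forall phi, A phi -> exists (s : seq W) (e : R), 0 < e /\
    forall psi, dual psi ->
      (forall w, w \in s -> `|psi w - phi w| < e) -> A psi.

Definition wclosed (A : set (W -> R)) := A `<=` dual /\ wopen (dual `\` A).

Definition convex_in_dual (C : set (W -> R)) :=
  forall u v t, C u -> C v -> 0 <= t <= 1 -> C (comb t u v).

Definition cone_with_vertex (C : set (W -> R)) (v0 : W -> R) :=
  C v0 /\ forall (l : R) v, 0 <= l -> C v -> v <> v0 -> C (comb l v0 v).

Definition convex_cone_with_vertex (C : set (W -> R)) (v0 : W -> R) :=
  [/\ C `<=` dual, cone_with_vertex C v0 & convex_in_dual C].

End Dual.

Section MapProps.
Context {R : realType} {W : completeNormedModType R} {X : topologicalType}.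
Variable f : X -> (W -> R).

Definition ncontinuous :=
  (forall x, dual (f x)) /\ forall A, nopen A -> open (f @^-1` A).

Definition local_convexity_data :=
  forall x : X, exists2 N : set X, nbhs x N &
    forall U : set X, open U -> U x -> U `<=` N ->
      exists C : set (W -> R),
        [/\ convex_cone_with_vertex C (f x),
            f @` U `<=` C /\ nnbhs_in C (f x) (f @` U),
            (forall O : set X, open O -> O `<=` U -> nopen_in C (f @` O))
          & (forall U' : set X, nbhs x U' -> U' `<=` U ->
               nnbhs_in C (f x) (f @` U'))].

Definition LFC (A : set X) :=
  forall a b c, A a -> A b -> A c -> f b = f a -> f c = f a ->
    connected_component (f @^-1` [set f a]) b =
    connected_component (f @^-1` [set f a]) c.

Definition locally_fiber_connected :=
  forall (x : X) (O : set X), open O -> O x ->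
    exists U : set X, [/\ nbhs x U, U `<=` O & LFC U].

Definition wclosed_map := forall C : set X, closed C -> wclosed (f @` C).

Definition wopen_onto_image :=
  forall O : set X, open O ->
    exists G : set (W -> R), wopen G /\ f @` O = G `&` range f.

End MapProps.

(* Main.v *)
Require Import Defs.
From HB Require Import structures.
From mathcomp Require Import all_boot all_order all_algebra.
From mathcomp Require Import all_classical all_reals.
From mathcomp Require Import topology normedtype.
From mathcomp Require Import interval_inference sequences lra ring.
Import Order.TTheory GRing.Theory Num.Theory.
Import numFieldNormedType.Exports.
Local Open Scope classical_set_scope.
Local Open Scope ring_scope.

(** Call [u] and [w] joined when a connected subset of [X] containing both is mapped
    into the segment [[f u, f w]]. If any two points are joined, then fibers are connected
    and the image is convex; openness follows since saturations of open sets are open.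

    Germs of charts agree along a connected component [E] of a fiber, so a small chart
    saturates to a neighbourhood of [E]. Normality separates [E] from the rest of its
    fiber, and closedness of [f] then shows that, for small [e], the component [sheet z e]
    of the preimage of the ball [B (f z) e] behaves like a relatively closed convex set
    ([good z e]). Closedness also makes [e] uniform near each point of the dual, hence
    over compact convex sets. Two points of [X] are linked by a finite chain of sheets
    over a zonotope; discrete curve shortening within sheets of uniform size straightens
    this chain into a lift of the segment between the end images. *)

(** * The dual norm distance, and segments in the dual *)

Section DualDistance.
Context {R : realType} {W : completeNormedModType R}.
Implicit Types (u v phi : W -> R) (a b e t : R).

Definition dist u v : R := dnorm (dsub u v).

Lemma dualZ phi a w : dual phi -> phi (a *: w) = a * phi w.
Proof.
move=> [lin _]; have phi0 : phi 0 = 0.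
  have := lin 1 0 0; rewrite scale1r addr0 mul1r => /eqP.
  by rewrite -subr_eq0 opprD addNKr oppr_eq0 => /eqP.
by rewrite -[a *: w]addr0 lin phi0 addr0.
Qed.

(** Continuity at 0 and homogeneity. The bound makes [dnorm] a genuine supremum on [dual] rather
    than a default value of [sup]. *)
Lemma dual_bounded phi : dual phi ->
  exists M : R, forall w : W, `|w| <= 1 -> `|phi w| <= M.
Proof.
move=> dphi; have phi0 : phi 0 = 0 by rewrite -(scale0r 0) dualZ// mul0r.
have /cvgr_dist_lt /(_ 1 ltr01) := dphi.2 0.
move=> /nbhs_ballP[e /= e0 He]; exists (2 / e) => w w1.
have : `|phi ((e / 2) *: w)| <= 1.
  have /He /ltW : ball 0 e ((e / 2) *: w).
    rewrite -ball_normE /= sub0r normrN normrZ gtr0_norm ?divr_gt0//.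
    by apply: (@le_lt_trans _ _ (e / 2)); [rewrite ler_piMr//; lra|lra].
  by rewrite phi0 sub0r normrN.
rewrite dualZ// normrM gtr0_norm ?divr_gt0// => le1.
by rewrite ler_pdivlMr// mulrC; lra.
Qed.

Lemma le_dist u v w : dual u -> dual v -> `|w| <= 1 -> `|u w - v w| <= dist u v.
Proof.
move=> du dv w1; apply: ub_le_sup; last by exists w.
have [M HM] := dual_bounded _ du; have [N HN] := dual_bounded _ dv.
exists (M + N) => _ [z /= z1 <-]; rewrite /dsub (le_trans (ler_normB _ _))//.
by rewrite lerD ?HM ?HN.
Qed.

Lemma dist_le u v e : (forall w : W, `|w| <= 1 -> `|u w - v w| <= e) ->
  dist u v <= e.
Proof.
move=> H; apply: ge_sup; first by exists `|dsub u v 0|; exists 0 => //=; rewrite normr0.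
by move=> _ [w /= w1 <-]; exact: H.
Qed.

Lemma distC u v : dist u v = dist v u.
Proof.
by congr (sup _); apply/seteqP; split => _ [w w1 <-]; exists w => //; rewrite /dsub distrC.
Qed.

Lemma dist_ge0 u v : dual u -> dual v -> 0 <= dist u v.
Proof.
by move=> du dv; apply: le_trans (le_dist u v 0 du dv _); rewrite ?normr_ge0 ?normr0.
Qed.

Lemma distxx u : dual u -> dist u u = 0.
Proof.
move=> du; apply/eqP; rewrite eq_le dist_ge0// andbT.
by apply: dist_le => w _; rewrite subrr normr0.
Qed.

Lemma le_dist_norm u v w : dual u -> dual v -> `|u w - v w| <= dist u v * `|w|.
Proof.
move=> du dv; have [->|w0] := eqVneq w 0.
  have zero phi : dual phi -> phi 0 = 0 by move=> d; rewrite -(scale0r 0) dualZ// mul0r.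
  by rewrite (zero u)// (zero v)// subrr !normr0 mulr0.
have nw : 0 < `|w| by rewrite normr_gt0.
have := le_dist u v (`|w|^-1 *: w) du dv _.
rewrite normrZ normfV normr_id mulVf ?gt_eqF// => /(_ (lexx 1)).
rewrite !dualZ// -mulrBr normrM normfV normr_id => H.
by rewrite -ler_pdivrMr// mulrC.
Qed.

Lemma dist_eq0 u v : dual u -> dual v -> dist u v <= 0 -> u = v.
Proof.
move=> du dv d0; apply/funext => w; apply/eqP; rewrite -subr_eq0 -normr_le0.
by apply: le_trans (le_dist_norm _ _ _ du dv) _; rewrite mulr_le0_ge0.
Qed.

Lemma dist_triangle v u phi : dual u -> dual v -> dual phi ->
  dist u phi <= dist u v + dist v phi.
Proof.
move=> du dv dp; apply: dist_le => w w1.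
have := le_dist _ _ _ du dv w1; have := le_dist _ _ _ dv dp w1.
by have := ler_normD (u w - v w) (v w - phi w); rewrite addrA subrK; lra.
Qed.

Lemma dual_lin a b u v : dual u -> dual v -> dual (fun w => a * u w + b * v w).
Proof.
move=> [lu cu] [lv cv]; split=> [c x y|x]; first by rewrite lu lv; ring.
by apply: cvgD; apply: cvgM; [exact: cvg_cst|exact: cu|exact: cvg_cst|exact: cv].
Qed.

Lemma dual_comb t u v : dual u -> dual v -> dual (comb t u v).
Proof. exact: dual_lin. Qed.

Lemma dual_sum n (s : nat -> R) (v : nat -> W -> R) : (forall i, dual (v i)) ->
  dual (fun w => \sum_(i < n) s i * v i w).
Proof.
move=> dv; elim: n => [|n IH].
  under eq_fun do rewrite big_ord0.
  by split=> [a x y|x]; [ring|exact: cvg_cst].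
under eq_fun do rewrite big_ord_recr /=.
have := dual_lin 1 (s n) _ _ IH (dv n).
by under eq_fun do rewrite mul1r.
Qed.

Lemma dist_comb phi t u v e : dual u -> dual v -> dual phi -> 0 <= t <= 1 ->
  dist u phi < e -> dist v phi < e -> dist (comb t u v) phi < e.
Proof.
(* A supremum of values below [e] need not be below [e], so the strict bound passes through the
   larger of the two distances. *)
move=> du dv dp t01 ue ve; apply: (@le_lt_trans _ _ (Num.max (dist u phi) (dist v phi)));
  last first.
  by rewrite gt_max ue.
apply: dist_le => w w1; rewrite le_max.
have := le_dist _ _ _ du dp w1; have := le_dist _ _ _ dv dp w1.
set A := dist u phi; set B := dist v phi; rewrite /comb.
have -> : (1 - t) * u w + t * v w - phi w = (1 - t) * (u w - phi w) + t * (v w - phi w) by ring.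
move=> Hv Hu; apply/orP.
have H : `|(1 - t) * (u w - phi w) + t * (v w - phi w)| <= (1 - t) * A + t * B.
  apply: le_trans (ler_normD _ _) _; rewrite !normrM (ger0_norm (x:=t)) ?(ger0_norm (x:=1-t));
    [|lra..].
  by apply: lerD; apply: ler_wpM2l => //; lra.
have [AB|BA] := leP A B; [right|left]; apply: le_trans H _; nra.
Qed.

Lemma dist_comb2 t s u v : dual u -> dual v ->
  dist (comb t u v) (comb s u v) <= `|t - s| * dist u v.
Proof.
move=> du dv; apply: dist_le => w w1; rewrite /comb.
have -> : (1 - t) * u w + t * v w - ((1 - s) * u w + s * v w) = (s - t) * (u w - v w) by ring.
by rewrite normrM distrC ler_wpM2l// le_dist.
Qed.

Lemma comb0 u v : comb 0 u v = u.
Proof. by apply/funext => w; rewrite /comb; ring. Qed.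

Lemma comb1 u v : comb 1 u v = v.
Proof. by apply/funext => w; rewrite /comb; ring. Qed.

Lemma combxx t u : comb t u u = u.
Proof. by apply/funext => w; rewrite /comb; ring. Qed.

Definition segment u v : set (W -> R) := [set comb t u v | t in `[0, 1]].

Lemma segmentP t u v : 0 <= t <= 1 -> segment u v (comb t u v).
Proof. by move=> t01; exists t => //=; rewrite in_itv. Qed.

Lemma segmentl u v : segment u v u.
Proof. by rewrite -{2}(comb0 u v); apply: segmentP; lra. Qed.

Lemma segmentr u v : segment u v v.
Proof. by rewrite -{2}(comb1 u v); apply: segmentP; lra. Qed.

Lemma segment_ball phi e u v : dual u -> dual v -> dual phi ->
  dist u phi < e -> dist v phi < e ->
  forall psi, segment u v psi -> dist psi phi < e.
Proof.
by move=> du dv dp ue ve _ [t t01 <-]; apply: dist_comb => //; move: t01; rewrite /= in_itv.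
Qed.

Lemma segment_segment u v s t : 0 <= s <= 1 -> 0 <= t <= 1 ->
  segment (comb s u v) (comb t u v) `<=` segment u v.
Proof.
move=> s01 t01 _ [r /= r01 <-]; move: r01; rewrite in_itv /= => r01.
have -> : comb r (comb s u v) (comb t u v) = comb ((1 - r) * s + r * t) u v.
  by apply/funext => w; rewrite /comb; ring.
by apply: segmentP; apply/andP; split; nra.
Qed.

Lemma nopen_ball v e : dual v -> nopen [set u | dual u /\ dist u v < e].
Proof.
move=> dv; split=> [u []//|u [du uve]]; exists (e - dist u v); first by rewrite subr_gt0.
move=> psi dpsi; rewrite -/(dist _ _) => H; split => //.
by have := dist_triangle u psi v dpsi du dv; lra.
Qed.

(** Each evaluation is Lipschitz for the dual norm, so finitely many are controlled at once: the
    norm topology refines the weak-star one. *)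
Lemma wopen_nbhs (A : set (W -> R)) phi : Defs.wopen A -> A phi ->
  exists2 e : R, 0 < e & forall psi, dual psi -> dist psi phi < e -> A psi.
Proof.
move=> [Ad HA] Aphi; have [s [e [e0 He]]] := HA _ Aphi.
pose M := 1 + \sum_(w <- s) `|w|.
have M0 : 0 < M by rewrite ltr_pwDl// sumr_ge0.
exists (e / M); first by rewrite divr_gt0.
move=> psi dpsi; rewrite ltr_pdivlMr// => H; apply: He => // w ws.
apply: le_lt_trans H; apply: le_trans (le_dist_norm _ _ _ dpsi (Ad _ Aphi)) _.
rewrite ler_wpM2l ?dist_ge0//; first exact: Ad.
rewrite /M (big_rem w) //=.
have : 0 <= \sum_(y <- rem w s) `|y| by rewrite sumr_ge0.
lra.
Qed.

End DualDistance.

(** * Connectedness through locally constant predicates *)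

Section Topology.
Context {X : topologicalType}.

(** The part of [A] where [P] holds is relatively open and relatively closed. This serves throughout
    as induction along connected sets. *)
Lemma connected_locally_constant (A : set X) (P : X -> Prop) x :
  connected A -> (forall y, A y -> exists2 U, nbhs y U & forall z, U z -> A z -> P y <-> P z) ->
  A x -> P x -> forall y, A y -> P y.
Proof.
move=> cA lc Ax Px; suff <- : [set y | A y /\ P y] = A by move=> y [].
apply: cA; first by exists x.
- exists [set y | A y -> P y]°; first exact: open_interior.
  apply/seteqP; split=> y /=; last first.
    by move=> [Ay /interior_subset HP]; split => //; exact: HP.
  move=> [Ay Py]; split => //; have [U Uy HU] := lc _ Ay.
  by apply: filterS Uy => z Uz Az; apply/(HU _ Uz Az).
- exists (~` [set y | A y -> ~ P y]°); first exact/open_closedC/open_interior.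
  apply/seteqP; split=> y /=.
    by move=> [Ay Py]; split => // /interior_subset /(_ Ay).
  move=> [Ay nP]; split => //; apply: contrapT => nPy; apply: nP.
  have [U Uy HU] := lc _ Ay.
  by apply: filterS Uy => z Uz Az Pz; apply: nPy; apply/(HU _ Uz Az).
Qed.

Lemma locally_connected_component_open (U : set X) x :
  locally_connected_space X -> open U -> open (connected_component U x).
Proof.
move=> lcX oU; rewrite openE => y Cy.
have Uy : U y by exact: connected_component_sub Cy.
have [V [oV Vy cV VU]] := lcX y U (open_nbhs_nbhs (conj oU Uy)).
apply: filterS (open_nbhs_nbhs (conj oV Vy)) => z Vz.
apply: connected_component_trans Cy _.
by exists V.
Qed.

Lemma component_relatively_closed (U : set X) x y :
  locally_connected_space X -> open U ->
  closure (connected_component U x) y -> U y -> connected_component U x y.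
Proof.
move=> lcX oU cly Uy.
have [V [oV Vy cV VU]] := lcX y U (open_nbhs_nbhs (conj oU Uy)).
have [z [Cz Vz]] := cly _ (open_nbhs_nbhs (conj oV Vy)).
by apply: connected_component_trans Cz _; exists V.
Qed.

End Topology.

(** Converse of [connected_locally_constant]: membership in a relatively clopen subset is itself
    locally constant. *)
Lemma locally_constant_connected {X : topologicalType} (A : set X) :
  (forall P : X -> Prop,
    (forall y, A y -> exists2 U, nbhs y U & forall z, U z -> A z -> P y <-> P z) ->
    forall x y, A x -> A y -> P x -> P y) ->
  connected A.
Proof.
move=> H B [b Bb] [C oC BC] [D cD BD].
apply/seteqP; split=> [y|y Ay]; first by rewrite BC => -[].
have Ab : A b by move: Bb; rewrite BC => -[].
apply: H Ab Ay Bb => z Az; have [Bz|nBz] := pselect (B z).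
  exists C; first by apply: open_nbhs_nbhs; split => //; move: Bz; rewrite BC => -[].
  by move=> t Ct At; split => // _; rewrite BC.
exists (~` D); first apply: open_nbhs_nbhs.
  by split; [exact: closed_openC | move=> Dz; apply: nBz; rewrite BD].
by move=> t nDt At; split => // Bt; exfalso; apply: nDt; move: Bt; rewrite BD => -[].
Qed.

(** * Fiber components, saturations, sheets and charts *)

Section Sheets.
Context {R : realType} {W : completeNormedModType R} {X : topologicalType}.
Variable f : X -> (W -> R).
Implicit Types (x y z u w : X) (v : W -> R) (e t : R) (U : set X) (C : set (W -> R)).

Definition preball v e : set X := [set x | dist (f x) v < e].
Definition fcomp x : set X := connected_component (f @^-1` [set f x]) x.
Definition sat U : set X := \bigcup_(x in U) fcomp x.
Definition sheet z e : set X := connected_component (preball (f z) e) z.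

Definition joined u w := exists A : set X,
  [/\ connected A, A u, A w & forall x, A x -> segment (f u) (f w) (f x)].

(** In the curve shortening the first clause supplies midpoints, the second the sets that join
    lifts, the third lifts of norm limits. *)
Definition good z e :=
  [/\ (forall u w t, sheet z e u -> sheet z e w -> 0 <= t <= 1 ->
        exists2 y, sheet z e y & f y = comb t (f u) (f w)),
      (forall u w, sheet z e u -> sheet z e w -> joined u w)
    & (forall v, dual v -> dist v (f z) < e ->
        (forall d, 0 < d -> exists2 y, sheet z e y & dist (f y) v < d) ->
        exists2 y, sheet z e y & f y = v)].

(** A form of the local convexity data without a base point, so that one chart serves at every point
    of [U]. *)
Definition chart U C :=
  [/\ open U, LFC f U, C `<=` dual, convex_in_dual C
    & forall O, open O -> O `<=` U -> nopen_in C (f @` O)].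

Lemma fcomp_eq x y : fcomp x y -> f y = f x.
Proof. by move=> /connected_component_sub. Qed.

Lemma fcomp_refl x : fcomp x x.
Proof. exact: connected_component_refl. Qed.

Lemma fcomp_sym x y : fcomp x y -> fcomp y x.
Proof.
by move=> xy; rewrite /fcomp (fcomp_eq _ _ xy); exact: connected_component_sym.
Qed.

Lemma fcomp_trans y x z : fcomp x y -> fcomp y z -> fcomp x z.
Proof.
move=> xy; rewrite /fcomp (fcomp_eq _ _ xy); exact: connected_component_trans.
Qed.

Lemma LFC_fcomp U x y : LFC f U -> U x -> U y -> f x = f y -> fcomp x y.
Proof.
move=> lfc Ux Uy fxy; rewrite /fcomp (lfc x x y)//.
exact: connected_component_refl.
Qed.

Lemma sat_sub U : U `<=` sat U.
Proof. by move=> x Ux; exists x => //; exact: fcomp_refl. Qed.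

(** Both points slide along their fiber components into [U], where (LFC) applies. *)
Lemma sat_LFC U x y : LFC f U -> sat U x -> sat U y -> f x = f y -> fcomp x y.
Proof.
move=> lfc [x' Ux' cx] [y' Uy' cy] fxy.
apply: (fcomp_trans x'); first exact: fcomp_sym.
apply: (fcomp_trans _ _ _ _ cy); apply: (LFC_fcomp _ _ _ lfc) => //.
by rewrite -(fcomp_eq _ _ cx) -(fcomp_eq _ _ cy).
Qed.

Lemma exists_chart x O : local_convexity_data f -> locally_fiber_connected f ->
  nbhs x O -> exists U C, [/\ chart U C, U x & U `<=` O].
Proof.
move=> lcd lfc xO; have [N xN HN] := lcd x.
have xON : (O `&` N)° x by exact: (@filterI _ _ (nbhs_filter x)).
(* (LFC) passes to subsets, so the interior of this neighbourhood can be the chart domain. *)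
have [U [xU UON lU]] := lfc x _ (open_interior _) xON.
have sU : U° `<=` O `&` N by move=> y /interior_subset /UON /interior_subset.
have [|C [[Cd _ Ccv] _ HC _]] := HN U° (open_interior _) xU.
  by move=> y /sU[].
exists U°, C; split => //; last by move=> y /sU[].
split => //; first exact: open_interior.
by move=> a b c /interior_subset ? /interior_subset ? /interior_subset ?; exact: lU.
Qed.

Lemma chart_sub U C x : chart U C -> U x -> C (f x).
Proof. by move=> [oU _ _ _ H] Ux; have [+ _] := H U oU (@subset_refl _ _); apply; exists x. Qed.

Lemma chart_nbhs U C x N : chart U C -> U x -> nbhs x N ->
  nnbhs_in C (f x) (f @` N).
Proof.
move=> [oU _ _ _ H] Ux xN.
have [|_] := H (N° `&` U) (openI (open_interior _) oU); first by move=> y [].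
case/(_ (f x)); first by exists x.
by move=> e e0 He; exists e => // psi Cp pe; have [y [/interior_subset Ny _] <-] := He _ Cp pe;
  exists y.
Qed.

(* Overlapping charts through points of one fiber carry the same germ of convex
   set, so the germ of the chart at [x] propagates along the connected set [fcomp x]. *)
Lemma nbhs_sat U C x y : ncontinuous f -> local_convexity_data f ->
  locally_fiber_connected f -> chart U C -> U x -> fcomp x y -> nbhs y (sat U).
Proof.
move=> [fd fc] lcd lfc chU Ux xy.
pose P y := nbhs y (sat U) /\ forall N, nbhs y N -> nnbhs_in C (f x) (f @` N).
suff : P y by case.
apply: (@connected_locally_constant _ (fcomp x) P x _ _ _ _ _ xy); last 2 first.
- exact: fcomp_refl.
- split; last by move=> N; exact: (chart_nbhs U).
  by case: chU => oU *; apply: filterS (sat_sub _) (open_nbhs_nbhs (conj oU Ux)).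
- exact: component_connected.
move=> {xy}y xy; have [U' [C' [chU' yU' _]]] := exists_chart y setT lcd lfc filterT.
exists U'; first by case: chU' => oU' *; exact: open_nbhs_nbhs.
suff H x1 x2 : U' x1 -> U' x2 -> f x1 = f x -> f x2 = f x -> P x1 -> P x2.
  by move=> z Uz xz; split; apply: H => //; exact: fcomp_eq.
move=> U1 U2 f1 f2 [s1 n1].
have oU' : open U' by case: chU'.
have lU' : LFC f U' by case: chU'.
have Cd : C `<=` dual by case: chU.
have C'd : C' `<=` dual by case: chU'.
have nU i : U' i -> nbhs i U' by move=> ?; exact: open_nbhs_nbhs.
have [d d0 Hd] := n1 _ (nU _ U1).
have [d1 d10 Hd1] := chart_nbhs _ _ _ _ chU' U1 (filterI (nU _ U1) s1).
rewrite f1 in Hd1.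
split=> [|N N2].
(* A point [z] of [U'] near [x2] has its image in [C'] near [f x], hence shares it with some [n] in
   both [U'] and [sat U]; (LFC) puts [z] and [n] in one fiber component. *)
- have B2 : nbhs x2 [set z | dual (f z) /\ dist (f z) (f x) < d1].
    apply: open_nbhs_nbhs; split; first exact: fc (nopen_ball _ _ (fd x)).
    by rewrite /= f2 distxx.
  apply: filterS (filterI (nU _ U2) B2) => z [U'z [_ zd]].
  have [|n [U'n [a Ua an]] fn] := Hd1 (f z) _ zd; first exact: chart_sub chU' U'z.
  by exists a => //; apply: fcomp_trans an _; exact: LFC_fcomp lU' _ _ _.
- have [d2 d20 Hd2] := chart_nbhs _ _ _ _ chU' U2 N2; rewrite f2 in Hd2.
  exists (Num.min d d2); first by rewrite lt_min d0.
  move=> psi Cp; rewrite lt_min => /andP[pd pd2]; apply: Hd2 pd2.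
  by have [z U'z <-] := Hd _ Cp pd; exact: chart_sub chU' U'z.
Qed.

End Sheets.

(** * Existence of a good sheet at each point *)

Section Charts.
Context {R : realType} {W : completeNormedModType R} {X : topologicalType}.
Variable f : X -> (W -> R).
Hypotheses (fcont : ncontinuous f) (fclosed : wclosed_map f)
  (lcd : local_convexity_data f) (lfc : locally_fiber_connected f)
  (lcX : locally_connected_space X) (normX : normal_space X).
Implicit Types (x y z u w : X) (v : W -> R) (e t : R) (U : set X) (C : set (W -> R)).

Let fd x : dual (f x) := fcont.1 x.
#[local] Hint Resolve fd : core.

Lemma preball_open v e : dual v -> open (preball f v e).
Proof.
move=> dv; have := fcont.2 _ (nopen_ball v e dv).
by congr open; apply/seteqP; split=> x; [case|split].
Qed.

Lemma nbhs_preball x v e : dual v -> dist (f x) v < e -> nbhs x (preball f v e).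
Proof. by move=> dv xe; apply: open_nbhs_nbhs; split => //; exact: preball_open. Qed.

Lemma closed_preball v e : dual v -> closed [set x | dist (f x) v <= e].
Proof.
move=> dv x clx; rewrite /= leNgt; apply/negP => ex.
have [|y [/= ye]] := clx _ (nbhs_preball x (f x) (dist (f x) v - e) (fd x) _).
  by rewrite distxx// subr_gt0.
rewrite /preball /= => yx; have := dist_triangle (f y) (f x) v (fd x) (fd y) dv.
by rewrite (distC (f x) (f y)); lra.
Qed.

Lemma closed_fiber v : dual v -> closed (f @^-1` [set v]).
Proof.
move=> dv; have := closed_preball v 0 dv.
congr closed; apply/seteqP; split => x /=; first exact: dist_eq0.
by move=> ->; rewrite distxx.
Qed.

(** The image of a closed set is weak-star closed, hence norm closed. Closedness of [f] enters the
    metric arguments through this gap. *)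
Lemma dist_image_closed (Z : set X) v : closed Z -> dual v -> ~ (f @` Z) v ->
  exists2 e : R, 0 < e & forall x, Z x -> e <= dist (f x) v.
Proof.
move=> cZ dv nZv; have [_ oZ] := fclosed _ cZ.
have [e e0 He] := wopen_nbhs _ _ oZ (conj dv nZv).
exists e => // x Zx; rewrite leNgt; apply/negP => /(He _ (fd x)) [_]; apply.
by exists x.
Qed.

(** By [sat_LFC], a locally constant predicate on this set depends only on the image, hence on the
    segment parameter; openness of the chart makes it locally constant in that parameter. *)
Lemma connected_sat_segment U C v1 v2 : chart f U C -> C v1 -> C v2 ->
  segment v1 v2 `<=` f @` U ->
  connected [set y | sat f U y /\ segment v1 v2 (f y)].
Proof.
move=> chU C1 C2 sU; have [oU lU Cd Ccv HU] := chU.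
set A := [set y | _]; apply: locally_constant_connected => P lcP x y Ax Ay Px.
have Pcomp z1 z2 : A z1 -> fcomp f z1 z2 -> P z1 -> P z2.
  move=> Az1 z12 Pz1; have sub : fcomp f z1 `<=` A.
    move=> z z1z; have [[a Ua az1] sz1] := Az1.
    by split; [exists a => //; exact: fcomp_trans z1z|rewrite (fcomp_eq _ _ _ z1z)].
  apply: (@connected_locally_constant _ (fcomp f z1) P z1) => //.
  - exact: component_connected.
  - by move=> z /sub /lcP [V Vz HV]; exists V => // s Vs /sub; exact: HV.
  - exact: fcomp_refl.
have Pfib z1 z2 : A z1 -> A z2 -> f z1 = f z2 -> P z1 -> P z2.
  by move=> A1 A2 f12; apply: Pcomp => //; apply: sat_LFC lU _ _ _ => //; [case: A1|case: A2].
pose Q t := forall z, A z -> f z = comb t v1 v2 -> P z.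
have [s s01 fx] := Ax.2; have [t t01 fy] := Ay.2.
suff : Q t by apply.
apply: (@connected_locally_constant (R : topologicalType) `[0, 1]%classic Q s _ _ _ _ t t01) => //; last first.
- by move=> z Az fz; apply: Pfib Px => //; rewrite fz.
- move=> {x y Ax Ay Px s s01 fx t t01 fy} t t01.
  have [u Uu fu] : (f @` U) (comb t v1 v2) by apply: sU; exists t.
  have Au : A u by split; [exact: sat_sub|rewrite fu; exists t].
  have [V Vu HV] := lcP u Au.
  have uUV : nbhs u (U `&` V) by apply: filterI => //; exact: open_nbhs_nbhs.
  have [d d0 Hd] := chart_nbhs _ _ _ _ _ chU Uu uUV.
  have d12 : 0 <= dist v1 v2 by rewrite dist_ge0//; exact: Cd.
  (* The summand 1 keeps the divisor positive when [v1 = v2]. *)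
  exists [set s | `|s - t| * (1 + dist v1 v2) < d].
    apply/nbhs_ballP; exists (d / (1 + dist v1 v2)) => /=; first by rewrite divr_gt0// ltr_pwDl.
    by move=> s; rewrite -ball_normE /= ltr_pdivlMr ?ltr_pwDl// distrC.
  move=> s /= sd s01; have [||y [Uy Vy] fy] := Hd (comb s v1 v2).
  - by apply: Ccv => //; move: s01; rewrite /= in_itv.
  - rewrite fu -/(dist _ _); apply: le_lt_trans (dist_comb2 _ _ _ _ (Cd _ C1) (Cd _ C2)) _.
    by apply: le_lt_trans sd; rewrite ler_wpM2l//; lra.
  - have Ay : A y by split; [exact: sat_sub|rewrite fy; exists s].
    have -> : Q t <-> P u.
      by split=> [/(_ u Au fu)//|Pu z Az fz]; apply: Pfib Pu => //; rewrite fz.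
    have -> : Q s <-> P y.
      by split=> [/(_ y Ay fy)//|Py z Az fz]; apply: Pfib Py => //; rewrite fz.
    exact: HV.
- exact: segment_connected.
Qed.

Lemma sheet_refl z e : 0 < e -> sheet f z e z.
Proof. by move=> e0; apply: connected_component_refl; rewrite /preball /= distxx. Qed.

(** The radius is such that the sheet lies in the saturation of a chart and every point of [C] in
    the ball lifts to that chart. The clauses then follow from convexity of [C], connectedness over
    segments and closedness of [f]. *)
Lemma exists_good x : exists2 e : R, 0 < e & good f x e.
Proof.
have [U [C [chU Ux _]]] := exists_chart f x setT lcd lfc filterT.
have [oU lU Cd Ccv HU] := chU.
have [d d0 Hd] := chart_nbhs _ _ _ _ _ chU Ux (open_nbhs_nbhs (conj oU Ux)).
have cE : closed (fcomp f x) by exact/component_closed/closed_fiber.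
(* A limit of other fiber points cannot lie in [fcomp f x]: an (LFC) neighbourhood would put those
   points in the same component. *)
have cE2 : closed ((f @^-1` [set f x]) `\` fcomp f x).
  move=> y cly; have fy : f y = f x.
    by apply: (closed_fiber (f x)) => // B /cly [z [[]]] fz _ Bz; exists z.
  split => // xy; have [V [yV _ lV]] := lfc y setT openT I.
  have [z [[fz nz] Vz]] := cly _ yV; apply: nz; apply: fcomp_trans xy _.
  by apply: (LFC_fcomp _ _ _ _ lV) => //; [exact: nbhs_singleton|rewrite fy fz].
(* [Q] also absorbs the complement of the interior of [sat f U], which forces [P] into [sat f U]. *)
have [P [Q [oP oQ EP FQ PQ0]]] := (normal_openP (R:=R)).1 normX _
  (((f @^-1` [set f x]) `\` fcomp f x) `|` ~` (sat f U)°) cE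
  (closedU cE2 (open_closedC (open_interior _)))
  ltac:(apply/seteqP; split => // y [xy [[_ /(_ xy)]//|]]; apply;
    exact: nbhs_sat fcont lcd lfc chU Ux xy).
have Psat : P `<=` sat f U.
  move=> y Py; apply: interior_subset; apply: contrapT => ny.
  by have : (P `&` Q) y; [split => //; apply: FQ; right|rewrite PQ0].
(* [P] and [Q] cover the fiber over [f x], so the remaining closed set has its image at distance at
   least [d1] from [f x]. *)
have [|||d1 d10 Hd1] := dist_image_closed (~` (P `|` Q)) (f x).
- exact/open_closedC/openU.
- exact: fd.
- move=> [y nPQ fy]; apply: nPQ; have [xy|xy] := pselect (fcomp f x y).
    by left; exact: EP.
  by right; apply: FQ; left.
pose e := Num.min d d1; have e0 : 0 < e by rewrite lt_min d0.
have sheetU : sheet f x e `<=` sat f U.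
  move=> y xy; apply: Psat.
  (* Over the ball only [P] and [Q] remain; open and disjoint, they make membership in [P] locally
     constant on the sheet. *)
  apply: (@connected_locally_constant _ (sheet f x e) P x _ _ _ _ _ xy).
  - exact: component_connected.
  - move=> z xz; have : (P `|` Q) z.
      apply: contrapT => /Hd1; have := connected_component_sub xz.
      by rewrite /preball /= /e lt_min => /andP[_]; lra.
    case=> [Pz|Qz]; first by exists P => //; exact: open_nbhs_nbhs.
    have nPQ s : Q s -> ~ P s by move=> Qs Ps; have : (P `&` Q) s by []; rewrite PQ0.
    exists Q; first exact: open_nbhs_nbhs.
    by move=> s Qs _; split => [/(nPQ _ Qz)|/(nPQ _ Qs)].
  - exact: sheet_refl.
  - exact/EP/fcomp_refl.
have sheetC y : sheet f x e y -> C (f y).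
  move=> /sheetU [a Ua ay]; rewrite (fcomp_eq _ _ _ ay); exact: chart_sub chU Ua.
have Cx : C (f x) by exact: chart_sub chU Ux.
have lift v : C v -> dist v (f x) < e -> (f @` U) v.
  by move=> Cv; rewrite lt_min => /andP[vd _]; exact: Hd.
have segC v1 v2 : C v1 -> C v2 -> segment v1 v2 `<=` C.
  by move=> C1 C2 _ [t t01 <-]; apply: Ccv => //; move: t01; rewrite /= in_itv.
have seglift v1 v2 : C v1 -> C v2 -> dist v1 (f x) < e -> dist v2 (f x) < e ->
    segment v1 v2 `<=` f @` U.
  move=> C1 C2 d1e d2e psi s12; apply: lift; first exact: segC s12.
  by apply: segment_ball s12 => //; exact: Cd.
(* The part of [sat f U] over the segment from [f x] to [v] is connected and contains both [x] and
   the lift. *)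
have sheetlift v : C v -> dist v (f x) < e -> exists2 y, sheet f x e y & f y = v.
  move=> Cv ve; have [y Uy fy] := lift _ Cv ve; exists y => //.
  have xe : dist (f x) (f x) < e by rewrite distxx.
  exists [set y | sat f U y /\ segment (f x) v (f y)].
    split; first by split; [exact: sat_sub|exact: segmentl].
      by move=> z [_ sz]; apply: segment_ball sz => //; exact: Cd.
    exact: connected_sat_segment chU Cx Cv (seglift _ _ Cx Cv xe ve).
  by split; [exact: sat_sub|rewrite fy; exact: segmentr].
have sheete y : sheet f x e y -> dist (f y) (f x) < e by move/connected_component_sub.
exists e => //; split=> [u w t xu xw t01|u w xu xw|v dv ve lim].
- apply: sheetlift; first by apply: Ccv => //; exact: sheetC.
  by apply: dist_comb => //; exact: sheete.
- exists [set y | sat f U y /\ segment (f u) (f w) (f y)]; split.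
  + apply: connected_sat_segment chU _ _ _; [exact: sheetC..|].
    by apply: seglift; try exact: sheetC; exact: sheete.
  + by split; [exact: sheetU|exact: segmentl].
  + by split; [exact: sheetU|exact: segmentr].
  + by move=> y [].
(* Closing the sheet up at a radius strictly between [dist v (f x)] and [e] gives a closed set whose
   points are still in the sheet; if its image missed [v], the gap would contradict [lim]. *)
- pose r := (e + dist v (f x)) / 2.
  pose Z := closure (sheet f x e) `&` [set y | dist (f y) (f x) <= r].
  have cZ : closed Z by apply: closedI; [exact: closed_closure|exact: closed_preball].
  have [[z [clz zr] fz]|nv] := pselect ((f @` Z) v).
    exists z => //; apply: component_relatively_closed => //; first exact: preball_open.
    by rewrite /preball /=; move: zr; rewrite /r /=; lra.
  have [c c0 Hc] := dist_image_closed Z v cZ dv nv.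
  have [|y xy] := lim (Num.min c ((e - dist v (f x)) / 2)).
    by rewrite lt_min c0 /=; lra.
  rewrite lt_min => /andP[yc yr]; have := Hc y; rewrite leNgt yc /= => H; exfalso.
  suff : Z y by move/H.
  split; first exact: subset_closure.
  have := dist_triangle v (f y) (f x) (fd y) dv (fd x).
  by rewrite /= /r; lra.
Qed.

End Charts.

(** * Uniform size of good sheets near a point of the dual *)

Section UniformSheets.
Context {R : realType} {W : completeNormedModType R} {X : topologicalType}.
Variable f : X -> (W -> R).
Hypotheses (fcont : ncontinuous f) (fclosed : wclosed_map f)
  (lcd : local_convexity_data f) (lfc : locally_fiber_connected f)
  (lcX : locally_connected_space X) (normX : normal_space X)
  (hausX : hausdorff_space X) (connX : connected [set: X]).
Implicit Types (x y z u w : X) (v : W -> R) (e t : R) (U : set X) (C : set (W -> R)).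

Let fd x : dual (f x) := fcont.1 x.
#[local] Hint Resolve fd : core.

Lemma sheet_dist z e y : sheet f z e y -> dist (f y) (f z) < e.
Proof. by move/connected_component_sub. Qed.

Lemma sheet_trans y z w a b c : sheet f z a y -> sheet f y b w -> a <= c ->
  dist (f y) (f z) + b <= c -> sheet f z c w.
Proof.
move=> [A [Az Aa cA] Ay] [B [By Bb cB] Bw] ac bc.
apply: (@connected_component_trans _ _ y).
  by exists A => //; split => // p /Aa pa; exact: lt_le_trans pa ac.
exists B => //; split => // p /Bb; rewrite /preball /= => pb.
by have := dist_triangle (f y) (f p) (f z) (fd p) (fd y) (fd z); lra.
Qed.

(** Balls are convex, so the joining set never leaves the ball around [f u]. *)
Lemma joined_sheet u w e : joined f u w -> dist (f w) (f u) < e -> sheet f u e w.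
Proof.
move=> [A [cA Au Aw AS]] we; exists A => //; split => // p /AS.
apply: segment_ball => //; rewrite distxx//.
by apply: le_lt_trans we; exact: dist_ge0.
Qed.

(** Within a good sheet, the distance between images alone decides whether one point lies in the
    sheet of another. *)
Lemma good_sheet z e u w r : good f z e -> sheet f z e u -> sheet f z e w ->
  dist (f w) (f u) < r -> sheet f u r w.
Proof. by move=> [_ H _] zu zw; apply: joined_sheet; exact: H. Qed.

Lemma sheet_sym z e y : 0 < e -> good f z e -> sheet f z e y -> sheet f y e z.
Proof.
move=> e0 gz zy; apply: (good_sheet z e) => //; first exact: sheet_refl.
by rewrite distC; exact: sheet_dist.
Qed.

(** Points found in the large sheet are brought back into the small one by [good_sheet]. *)
Lemma good_sub z e y r : 0 < r -> good f z e -> sheet f z e y ->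
  dist (f y) (f z) + r <= e -> good f y r.
Proof.
move=> r0 gz zy yr; have [Ha Hb Hc] := gz.
have sub w : sheet f y r w -> sheet f z e w.
  by move=> yw; apply: sheet_trans zy yw _ _.
split=> [u w t yu yw t01|u w yu yw|v dv vr lim].
- have [p zp fp] := Ha u w t (sub _ yu) (sub _ yw) t01; exists p => //.
  apply: (good_sheet z e) => //; rewrite fp.
  by apply: dist_comb => //; exact: sheet_dist.
- by apply: Hb; exact: sub.
- have [||p zp fp] := Hc v dv.
  + by have := dist_triangle (f y) v (f z) dv (fd y) (fd z); lra.
  + by move=> d /lim [p yp pd]; exists p => //; exact: sub.
  + by exists p => //; apply: (good_sheet z e) => //; rewrite fp.
Qed.

(** Points of [X] are closed, so the first terms of [q] can be removed from a neighbourhood of [y]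
    one at a time. *)
Lemma closure_range_tail (q : nat -> X) y n (N : set X) :
  closure (range q) y -> ~ range q y -> nbhs y N ->
  exists2 m, (n <= m)%N & N (q m).
Proof.
move=> cly ny; elim: n N => [|n IH] N yN.
  by have [_ [[m _ <-] Nm]] := cly _ yN; exists m.
have [|m nm [Nm qm]] := IH (N `&` ~` [set q n]).
  apply: filterI => //; apply: open_nbhs_nbhs; split.
    exact/closed_openC/accessible_closed_set1/hausdorff_accessible.
  by move=> /= yq; apply: ny; exists n.
exists m => //; rewrite ltn_neqAle nm andbT; apply/eqP => nm'.
by apply: qm; rewrite /= nm'.
Qed.

(* If a sheet lies in one fiber it is clopen, so [f] is constant. *)
Lemma good_constant z e : 0 < e -> (forall q, sheet f z e q -> f q = f z) ->
  good f z e.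
Proof.
move=> e0 Hz; have all y : sheet f z e y.
  apply: (@connected_locally_constant _ setT (sheet f z e) z) => //; last first.
    exact: sheet_refl.
  move=> p _; have oz : open (sheet f z e).
    by apply: locally_connected_component_open => //; exact: preball_open.
  have cz : closed (sheet f z e).
    move=> q clq; have fq : f q = f z.
      by apply: (closed_fiber f fcont (f z)) => // B /clq [s [/Hz]]; exists s.
    apply: component_relatively_closed => //; first exact: preball_open.
    by rewrite /preball /= fq distxx.
  have [zp|nzp] := pselect (sheet f z e p).
    by exists (sheet f z e) => //; exact: open_nbhs_nbhs.
  exists (~` sheet f z e); first by apply: open_nbhs_nbhs; split => //; exact: closed_openC.
  by move=> q nq _; split.
have fz q : f q = f z by exact: Hz.
split=> [u w t _ _ _|u w _ _|v dv ve lim].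
- by exists z => //; rewrite (fz u) (fz w) combxx.
- by exists setT; split => // x _; rewrite (fz x) (fz u); exact: segmentl.
- exists z => //; apply: dist_eq0 => //; rewrite leNgt; apply/negP => d0.
  by have [y _] := lim _ d0; rewrite (fz y) ltxx.
Qed.

(** Otherwise points with bad sheets have images tending to [v]. Closedness of [f] gives them an
    accumulation point [y] over [v], and the good sheet at [y] contains good sheets around those
    nearby. *)
Lemma good_near v : dual v ->
  exists2 e : R, 0 < e & forall z, dist (f z) v < e -> good f z e.
Proof.
move=> dv; apply: contrapT => nU.
have [h h0 small] : exists2 h : nat -> R, forall n, 0 < h n &
    forall r, 0 < r -> exists n, forall m, (n <= m)%N -> h m < r.
  exists (fun n => n.+1%:R^-1) => [n|r r0]; first by rewrite invr_gt0 ltr0n.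
  by have [N _ HN] := near_infty_natSinv_lt (PosNum r0); exists N => m /HN.
(* The sequence must avoid the fiber over [v], since the gap exists only for values missed by the
   closed set. A bad [z] over [v] is traded for a point of its sheet off the fiber, hence the
   doubled radius. *)
have H n : exists q, [/\ f q <> v, dist (f q) v < h n & ~ good f q (2 * h n)].
  set e := h n; have e0 : 0 < e by exact: h0.
  have [z [zv nz]] : exists z, dist (f z) v < e /\ ~ good f z e.
    apply: contrapT => nz; apply: nU; exists e => // z zv.
    by apply: contrapT => ngz; apply: nz; exists z.
  have [fz|fz] := pselect (f z = v); last first.
    exists z; split => // g2; apply: nz; apply: good_sub g2 _ _ => //.
      by apply: sheet_refl => //; lra.
    by rewrite distxx//; lra.
  have [q zq fq] : exists2 q, sheet f z e q & f q <> f z.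
    apply: contrapT => nq; apply: nz; apply: good_constant => // q zq.
    by apply: contrapT => fq; apply: nq; exists q.
  have zqe := sheet_dist _ _ _ zq.
  exists q; rewrite -fz; split => // gq; apply: nz; apply: good_sub gq _ _ => //.
    have [A [Az As cA] Aq] := zq; exists A => //; split => // p /As.
    rewrite /preball /= => pz.
    by have := dist_triangle (f z) (f p) (f q) (fd p) (fd z) (fd q); rewrite (distC (f z)); lra.
  by rewrite distC; lra.
have [q Hq] := choice H.
(* Otherwise [range q] is closed with image missing [v], and the images keep a positive distance
   from [v]. *)
have [y cly ny] : exists2 y, closure (range q) y & ~ range q y.
  apply: contrapT => nc; have cq : closed (range q).
    by move=> y cly; apply: contrapT => ny; apply: nc; exists y.
  have [|e e0 He] := dist_image_closed f fcont fclosed _ v cq dv.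
    by move=> [_ [n _ <-] fq]; have [] := Hq n.
  have [n /(_ n (leqnn n)) Hn] := small e e0.
  by have [_ qn _] := Hq n;
    have := lt_le_trans (lt_trans qn Hn) (He (q n) (ex_intro2 _ _ n I erefl)); rewrite ltxx.
have fy : f y = v.
  apply: dist_eq0 => //; rewrite leNgt; apply/negP => r0.
  set r := dist (f y) v in r0.
  have [|n Hn] := small (r / 2); first lra.
  have [|m nm qm] := closure_range_tail q y n (preball f (f y) (r / 2)) cly ny.
    by apply: nbhs_preball => //; rewrite distxx//; lra.
  have [_ qv _] := Hq m; have := Hn m nm; move: qm; rewrite /preball /= => qm.
  by have := dist_triangle (f (q m)) (f y) v (fd _) (fd _) dv; rewrite (distC (f y) (f _)) -/r; lra.
have [e e0 gy] := exists_good f fcont fclosed lcd lfc lcX normX y.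
have [|n Hn] := small (e / 4); first lra.
have [|m nm [qm qe]] := closure_range_tail q y n (sheet f y e `&` preball f (f y) (e / 4)) cly ny.
  apply: filterI.
    apply: open_nbhs_nbhs; split; last exact: sheet_refl.
    by apply: locally_connected_component_open => //; exact: preball_open.
  by apply: nbhs_preball => //; rewrite distxx//; lra.
have [_ qv] := Hq m; apply; apply: good_sub gy qm _.
  by rewrite mulr_gt0.
by have := Hn m nm; move: qe; rewrite /preball /=; lra.
Qed.

End UniformSheets.

(** * Zonotopes in the dual *)

Section Zonotope.
Context {R : realType} {W : completeNormedModType R}.
Implicit Types (n : nat) (v : nat -> W -> R) (u z : W -> R).

(** The image of a cube: convex, and open to compactness arguments in finitely many coordinates.
    Independent coefficients, unlike those of a convex hull, make adding a generator immediate. *)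
Definition zonotope n v : set (W -> R) :=
  [set (fun w => \sum_(i < n) c i * v i w) | c in [set c : nat -> R | forall i, 0 <= c i <= 1]].

Lemma zonotope_convex n v : convex_in_dual (zonotope n v).
Proof.
move=> _ _ t [a /= a01 <-] [b /= b01 <-] t01.
exists (fun i => (1 - t) * a i + t * b i) => [i /=|].
  by have := a01 i; have := b01 i; move=> *; apply/andP; split; nra.
apply/funext => w; rewrite /comb !mulr_sumr -big_split /=.
by apply: eq_bigr => i _; ring.
Qed.

Lemma zonotope_extend n v z : exists2 v',
  dual z -> (forall i, dual (v i)) -> forall i, dual (v' i) &
  zonotope n v `<=` zonotope n.+1 v' /\ zonotope n.+1 v' z.
Proof.
pose v' i := if (i < n)%N then v i else z.
have v'n (i : 'I_n) : v' i = v i by rewrite /v' ltn_ord.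
exists v' => [dz dv i|]; first by rewrite /v'; case: ifP.
split=> [_ [c c01 <-]|].
  exists (fun i => if (i < n)%N then c i else 0) => [i /=|].
    by case: ifP => _; [exact: c01|rewrite lexx ler01].
  apply/funext => w; rewrite big_ord_recr /= ltnn mul0r addr0.
  by apply: eq_bigr => i _; rewrite v'n ltn_ord.
exists (fun i => (i == n)%:R) => [i /=|]; first by case: (i == n); rewrite lexx ler01.
apply/funext => w; rewrite big_ord_recr /= eqxx mul1r /v' ltnn big1 ?add0r// => i _.
by rewrite ltn_eqF ?mul0r.
Qed.

End Zonotope.

(** * A uniform radius over a zonotope, and chains of sheets *)

Section Chains.
Context {R : realType} {W : completeNormedModType R} {X : topologicalType}.
Variable f : X -> (W -> R).
Hypotheses (fcont : ncontinuous f) (fclosed : wclosed_map f)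
  (lcd : local_convexity_data f) (lfc : locally_fiber_connected f)
  (lcX : locally_connected_space X) (normX : normal_space X)
  (hausX : hausdorff_space X) (connX : connected [set: X]).
Implicit Types (x y z u w : X) (e t : R) (U : set X).

Let fd x : dual (f x) := fcont.1 x.
#[local] Hint Resolve fd : core.

Lemma good_le z e r : 0 < r -> r <= e -> good f z e -> good f z r.
Proof.
move=> r0 re gz; apply: (good_sub f fcont z e) => //.
  by apply: sheet_refl => //; exact: lt_le_trans re.
by rewrite distxx// add0r.
Qed.

(** By [good_near] each coefficient vector has a neighbourhood on which one radius serves;
    compactness of the cube gives one radius for all. *)
Lemma good_zonotope n (v : nat -> W -> R) : (forall i, dual (v i)) ->
  exists2 e : R, 0 < e & forall z, zonotope n v (f z) -> good f z e.
Proof.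
move=> dv.
pose L (c : 'rV[R]_n) : W -> R := fun w : W => \sum_(i < n) c ord0 i * v i w.
have dL c : dual (L c).
  (* [insub] extends the row by 0, since [dual_sum] expects coefficients on all of [nat]. *)
  have -> : L c = fun w : W => \sum_(i < n) (if insub (i : nat) is Some j then c ord0 j else 0) * v i w.
    by apply/funext => w; apply: eq_bigr => i _; rewrite valK.
  exact: (dual_sum n (fun i => if insub i is Some j then c ord0 j else 0)).
have [B HB] := choice (fun i => dual_bounded (v i) (dv i)).
have B0 i : 0 <= B i by apply: le_trans (HB i 0 _); rewrite ?normr0// normr_ge0.
have LB (c c' : 'rV[R]_n) (d : R) : (forall i, `|c' ord0 i - c ord0 i| <= d) ->
    dist (L c') (L c) <= d * \sum_(i < n) B i.
  move=> H; apply: dist_le => w w1; rewrite /L -sumrB.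
  apply: le_trans (ler_norm_sum _ _ _) _; rewrite mulr_sumr.
  apply: ler_sum => i _; rewrite -mulrBl normrM.
  by apply: ler_pM => //; exact: HB.
pose K := [set c : 'rV[R]_n | forall i, `[0, 1]%classic (c ord0 i)].
have cK : compact K by apply: (@rV_compact R n (fun=> `[0, 1]%classic)) => i;
  exact: segment_compact.
have /compact_near_coveringP cov := cK.
have loc c : K c -> \forall c' \near c & e \near 0^'+,
    forall z, f z = L c' -> good f z e.
  move=> Kc; have [e e0 He] := good_near f fcont fclosed lcd lfc lcX normX hausX connX (L c) (dL c).
  (* By [LB], moving each coordinate by at most [d] moves [L c] by less than [e]. *)
  pose d := e / (1 + \sum_(i < n) B i).
  have S0 : 0 <= \sum_(i < n) B i by exact: sumr_ge0.
  have d0 : 0 < d by rewrite divr_gt0// ltr_pwDl.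
  exists (ball c d, [set r | 0 < r /\ r <= e]).
    split; first exact: nbhsx_ballx.
    by near=> r; split; near: r; [exact: nbhs_right_gt|exact: nbhs_right_le].
  move=> [c' r] [/= cc' [r0 re]] z fz; apply: (good_le z e) => //.
  apply: He; rewrite fz; apply: le_lt_trans (LB c c' d _) _.
    by move=> i; have [_ /(_ ord0 i)] := cc'; rewrite -ball_normE /= distrC => /ltW.
  by rewrite /d mulrAC ltr_pdivrMr ?ltr_pwDl// ltr_pM2l//; lra.
have near := cov R 0^'+ (fun e c => forall z, f z = L c -> good f z e)
  (at_right_proper_filter 0) loc.
have [e [/= e0 He]] := filter_ex (filterI (nbhs_right_gt (0 : R)) near).
exists e => // z [c c01 fz]; apply: (He (\row_i c i)) => [i /=|].
  by rewrite mxE in_itv /= c01.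
by rewrite -fz; apply/funext => w; apply: eq_bigr => i _; rewrite mxE.
Unshelve. all: by end_near. Qed.

(** Induction along [X]: within a good sheet the connected set is prolonged by one over a segment,
    and the new end image becomes a generator, so by convexity the segment lies in the zonotope. *)
Lemma connected_zonotope p r : exists n (v : nat -> W -> R) (A : set X),
  [/\ (forall i, dual (v i)), connected A, A p, A r
    & forall x, A x -> zonotope n v (f x)].
Proof.
apply: (@connected_locally_constant _ setT (fun r => exists n (v : nat -> W -> R) (A : set X),
  [/\ (forall i, dual (v i)), connected A, A p, A r
    & forall x, A x -> zonotope n v (f x)]) p) => //; last first.
  exists 1%N, (fun=> f p), [set p]; split => //; first exact: connected1.
  move=> _ ->; exists (fun=> 1) => [i /=|]; first by rewrite ler01 lexx.
  by apply/funext => w; rewrite big_ord_recr big_ord0 /= add0r mul1r.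
move=> y _; have [e e0 gy] := exists_good f fcont fclosed lcd lfc lcX normX y.
exists (sheet f y e).
  apply: open_nbhs_nbhs; split; last exact: sheet_refl.
  by apply: locally_connected_component_open => //; exact: preball_open.
suff H u w : joined f u w -> (exists n (v : nat -> W -> R) (A : set X),
  [/\ (forall i, dual (v i)), connected A, A p, A u
    & forall x, A x -> zonotope n v (f x)]) -> exists n (v : nat -> W -> R) (A : set X),
  [/\ (forall i, dual (v i)), connected A, A p, A w
    & forall x, A x -> zonotope n v (f x)].
  have [_ gj _] := gy; move=> z yz _; have yy := sheet_refl f fcont y e e0.
  by split; apply: H; exact: gj.
move=> [B [cB Bu Bw BS]] [n [v [A [dv cA Ap Au Av]]]].
have [v' dv' [vv' v'w]] := zonotope_extend n v (f w).
exists n.+1, v', (A `|` B); split => //.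
- exact: dv'.
- by apply: connectedU => //; exists u.
- by left.
- by right.
- move=> x [/Av/vv' //|/BS [t t01 <-]]; apply: zonotope_convex => //.
  exact/vv'/Av.
Qed.

(** Reachability by chains is locally constant on [A], because [sheet_sym] lets a link be traversed
    both ways. *)
Lemma sheet_chain (A : set X) p r e : connected A -> A p -> A r -> 0 < e ->
  (forall x, A x -> good f x e) ->
  exists N (x : nat -> X), [/\ x 0%N = p, x N = r,
    forall i, (i < N)%N -> sheet f (x i) e (x i.+1)
    & forall i, (i <= N)%N -> A (x i)].
Proof.
move=> cA Ap Ar e0 gA; pose P r := exists N (x : nat -> X), [/\ x 0%N = p, x N = r,
    forall i, (i < N)%N -> sheet f (x i) e (x i.+1)
    & forall i, (i <= N)%N -> A (x i)].
suff : P r by [].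
apply: (@connected_locally_constant _ A P p) => //; last first.
  by exists 0%N, (fun=> p); split => // i.
suff H y z : A y -> A z -> sheet f y e z -> P y -> P z.
  move=> y Ay; exists (sheet f y e).
    apply: open_nbhs_nbhs; split; last exact: sheet_refl.
    by apply: locally_connected_component_open => //; exact: preball_open.
  by move=> z yz Az; split; apply: H => //; apply: sheet_sym => //; exact: gA.
move=> Ay Az yz [N [x [x0 xN xs xA]]].
exists N.+1, (fun i => if (i <= N)%N then x i else z); split => //.
- by rewrite ltnn.
- move=> i; rewrite ltnS leq_eqVlt => /predU1P[->|iN] /=; first by rewrite eqxx ltnn xN.
  by rewrite iN orbT; exact: xs.
- by move=> i _; case: ifP => // /xA.
Qed.

End Chains.

(** * Equally spaced points on a segment *)

Section Grid.
Context {R : realType} {W : completeNormedModType R}.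
Implicit Types (a b c d : W -> R) (N i : nat).

Lemma dist_mid a b c d : dual a -> dual b -> dual c -> dual d ->
  dist (comb 2^-1 a b) (comb 2^-1 c d) <= (dist a c + dist b d) / 2.
Proof.
move=> da db dc dd; apply: dist_le => w w1; rewrite /comb.
have := le_dist _ _ _ da dc w1; have := le_dist _ _ _ db dd w1.
have -> : (1 - 2^-1) * a w + 2^-1 * b w - ((1 - 2^-1) * c w + 2^-1 * d w) =
  (a w - c w) / 2 + (b w - d w) / 2 by field.
have := ler_normD ((a w - c w) / 2) ((b w - d w) / 2).
rewrite !normrM (ger0_norm (x := 2^-1))//; lra.
Qed.

Definition grid a b N i : W -> R := comb (i%:R / N%:R) a b.

Lemma grid_segment a b N i : (i <= N)%N -> segment a b (grid a b N i).
Proof.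
move=> iN; apply: segmentP; rewrite divr_ge0//=.
have [->|N0] := posnP N; first by rewrite invr0 mulr0.
by rewrite ler_pdivrMr ?ltr0n// mul1r ler_nat.
Qed.

(** The grid is fixed by midpoint averaging, so distances to it are themselves averaged by a
    shortening step. *)
Lemma grid_mid a b N i : (0 < N)%N ->
  grid a b N i.+1 = comb 2^-1 (grid a b N i) (grid a b N i.+2).
Proof.
move=> N0; apply/funext => w; rewrite /grid /comb -!natr1.
by field; rewrite pnatr_eq0 -lt0n.
Qed.

End Grid.

(* Discrete curve shortening: each interior vertex of a chain of sheets is moved to the
   midpoint of its neighbours. The function [i * (N - i)] is a strict supersolution of
   this averaging, so the images converge geometrically to an equally spaced grid on the
   segment between the end points. *)
Section CurveShortening.
Context {R : realType} {W : completeNormedModType R} {X : topologicalType}.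
Variable f : X -> (W -> R).
Hypotheses (fcont : ncontinuous f).

Let fd x : dual (f x) := fcont.1 x.
#[local] Hint Resolve fd : core.

Definition admissible (K : set (W -> R)) (e : R) (p r : X) N (x : nat -> X) :=
  [/\ x 0%N = p, x N = r,
  forall i, (i < N)%N -> sheet f (x i) e (x i.+1)
  & forall i, (i <= N)%N -> K (f (x i))].

(** Goodness at radius [2 * e] puts consecutive new vertices in one good sheet, where only the
    distance of their images matters; that distance is bounded by a mean of old edge lengths. *)
Lemma shortening_step K e p r N x : convex_in_dual K -> 0 < e ->
  (forall z, K (f z) -> good f z (2 * e)) -> admissible K e p r N x ->
  exists x', [/\ admissible K e p r N x',
  forall i, (i.+1 < N)%N -> f (x' i.+1) = comb 2^-1 (f (x i)) (f (x i.+2))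
  & forall i, (i <= N)%N -> sheet f (x i) e (x' i)].
Proof.
move=> convK e0 goodK [x0 xN xs xK].
have goodKe z : K (f z) -> good f z e.
  by move/goodK => ?; apply: (good_le f fcont z (2 * e)) => //; lra.
have He i : (i < N)%N -> dist (f (x i.+1)) (f (x i)) < e by move/xs/sheet_dist.
(* The end vertices stay fixed; indices beyond [N] only make the choice total. *)
have : forall i, exists y, (if (0 < i < N)%N then
    f y = comb 2^-1 (f (x i.-1)) (f (x i.+1)) else y = x i) /\
    ((i <= N)%N -> sheet f (x i) e y).
  move=> i; case: (boolP (0 < i < N)%N) => [/andP[i0 iN]|_]; last by exists (x i); split => // _;
    exact: sheet_refl.
  have gi := goodKe _ (xK i (ltnW iN)); have [mid _ _] := gi.
  have iN1 : (i.-1 < N)%N by rewrite prednK// ltnW.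
  have [||y iy fy] := mid (x i.-1) (x i.+1) 2^-1 _ (xs _ iN); last by exists y.
  - have := xs _ iN1; rewrite prednK//; apply: sheet_sym => //.
    exact/goodKe/xK/ltnW.
  - by lra.
case/choice => x' Hx'; exists x'.
have x'0 : x' 0%N = x 0%N by have [] := Hx' 0%N.
have x'N : x' N = x N by have [] := Hx' N; rewrite ltnn andbF.
have x'mid i : (i.+1 < N)%N -> f (x' i.+1) = comb 2^-1 (f (x i)) (f (x i.+2)).
  by move=> iN; have [] := Hx' i.+1; rewrite iN.
have x's i : (i <= N)%N -> sheet f (x i) e (x' i) by have [] := Hx' i.
split => //; split; [by rewrite x'0|by rewrite x'N| |].
- move=> i iN; apply: (good_sheet f fcont (x i) (2 * e)); first exact/goodK/xK/ltnW.
  + by apply: (sheet_trans f fcont (x i) (x i) (x' i) e e) => //;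
      [exact: sheet_refl|exact/x's/ltnW|lra|rewrite distxx//; lra].
  + apply: (sheet_trans f fcont (x i.+1) (x i) (x' i.+1) e e) => //;
      [exact: xs|exact: x's|lra|].
    by have := He i iN; lra.
  + have stp a b c d : dual a -> dual b -> dual c -> dual d ->
        dist a c + dist b d < 2 * e -> dist (comb 2^-1 a b) (comb 2^-1 c d) < e.
      move=> da db dc dd H; apply: le_lt_trans (dist_mid _ _ _ _ da db dc dd) _; lra.
    have two j : (j.+1 < N)%N -> dist (f (x j.+2)) (f (x j)) < 2 * e.
      move=> jN; have := He _ jN; have := He _ (ltnW jN).
      by have := dist_triangle (f (x j.+1)) (f (x j.+2)) (f (x j)) (fd _) (fd _) (fd _); lra.
    (* A fixed end vertex counts as the midpoint of itself with itself. *)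
    case: i iN => [|i] iN.
      rewrite x'0; move: (iN); rewrite leq_eqVlt => /predU1P[N1|N1].
        by rewrite N1 x'N -N1; exact: He.
      rewrite (x'mid _ N1) -[X in dist _ X](combxx 2^-1); apply: stp => //.
      by rewrite distxx// add0r; exact: two.
    rewrite (x'mid _ iN).
    move: (iN); rewrite leq_eqVlt => /predU1P[N1|N1].
      rewrite N1 x'N -N1 -[X in dist X _](combxx 2^-1); apply: stp => //.
      by rewrite distxx// addr0; exact: two.
    rewrite (x'mid _ N1); apply: stp => //.
    have := He i (ltnW iN); have := He i.+2 N1; lra.
- move=> i iN; have [j|] := boolP (0 < i < N)%N; last first.
    by have [+ _] := Hx' i => /[swap] /negPf -> ->; exact: xK.
  have [+ _] := Hx' i; rewrite j => ->; case/andP: j => i0 iN'.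
  apply: convK; [|exact: xK|lra].
  by apply: xK; rewrite (leq_trans (leq_pred _)).
Qed.

Lemma shortening_error p r N (s : nat -> nat -> X) : (0 < N)%N ->
  (forall m, s m 0%N = p) -> (forall m, s m N = r) ->
  (forall m i, (i.+1 < N)%N ->
    f (s m.+1 i.+1) = comb 2^-1 (f (s m i)) (f (s m i.+2))) ->
  exists2 M : R, 0 <= M & forall m i, (i <= N)%N ->
  dist (f (s m i)) (grid (f p) (f r) N i) <=
    M * (1 - (N%:R ^+ 2)^-1) ^+ m * (i%:R * (N%:R - i%:R)).
Proof.
move=> N0 s0 sN s_mid; set g := grid (f p) (f r) N.
have gd i : dual (g i) by exact: dual_comb.
(* [M] dominates all initial errors, and [i * (N - i)] is at least 1 at interior vertices. *)
pose M : R := \sum_(i < N) dist (f (s 0%N i)) (g i).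
have M0 : 0 <= M by apply: sumr_ge0 => i _; exact: dist_ge0.
have g0 : g 0%N = f p by rewrite /g /grid mul0r comb0.
have gN : g N = f r by rewrite /g /grid divff ?comb1// pnatr_eq0 -lt0n.
have NR : 1 <= N%:R :> R by rewrite ler1n.
have N2 : 1 <= N%:R ^+ 2 :> R by exact: exprn_ege1.
(* Averaging lowers [i * (N - i)] by exactly 1, which is at least the fraction [1 / N ^ 2] of its
   value. *)
set q : R := 1 - (N%:R ^+ 2)^-1.
have q0 : 0 <= q by rewrite subr_ge0 invf_le1// (lt_le_trans ltr01 N2).
exists M => //; elim=> [|m IH] i iN.
all: have [->|i0] := posnP i; first by rewrite s0 g0 mul0r mulr0 distxx.
all: move: (iN); rewrite leq_eqVlt => /predU1P[->|iN'];
  first by rewrite sN gN subrr !mulr0 distxx.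
- rewrite expr0 mulr1; have dM : dist (f (s 0%N i)) (g i) <= M.
    rewrite /M (bigD1 (Ordinal iN')) //= lerDl.
    by apply: sumr_ge0 => j _; exact: dist_ge0.
  apply: le_trans dM _; rewrite ler_peMr//.
  have i1 : 1 <= i%:R :> R by rewrite ler1n.
  have i2 : i%:R + 1 <= N%:R :> R by rewrite natr1 ler_nat.
  by move: i1 i2; move: (i%:R) (N%:R) => a n a1 an; nra.
- case: i i0 iN iN' => // i _ iN iN'.
  rewrite (s_mid _ _ iN') /g grid_mid// -/g.
  apply: le_trans (dist_mid _ _ _ _ (fd _) (fd _) (gd _) (gd _)) _.
  have H1 := IH i (ltnW iN); have H2 := IH i.+2 iN'.
  have c0 : 0 <= M * q ^+ m by rewrite mulr_ge0// exprn_ge0.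
  have -> : M * q ^+ m.+1 * (i.+1%:R * (N%:R - i.+1%:R)) =
      M * q ^+ m * (q * (i.+1%:R * (N%:R - i.+1%:R))) by rewrite exprSr; ring.
  move: H1 H2 c0; set c := M * q ^+ m => H1 H2 c0.
  have i1E : i.+1%:R = i%:R + 1 :> R by rewrite natr1.
  have i2E : i.+2%:R = i%:R + 1 + 1 :> R by rewrite !natr1.
  rewrite i1E; rewrite i2E in H2.
  have a0 : 0 <= i%:R :> R by rewrite ler0n.
  have an : i%:R + 1 <= N%:R :> R by rewrite natr1 ler_nat.
  have k1 : (N%:R ^+ 2)^-1 * ((i%:R + 1) * (N%:R - (i%:R + 1))) <= 1 :> R.
    rewrite mulrC ler_pdivrMr; last exact: lt_le_trans N2.
    by rewrite mul1r expr2; nra.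
  have key : (i%:R * (N%:R - i%:R) + (i%:R + 1 + 1) * (N%:R - (i%:R + 1 + 1))) / 2 <=
      q * ((i%:R + 1) * (N%:R - (i%:R + 1))).
    by rewrite /q mulrBl mul1r; lra.
  have := ler_wpM2l c0 key; lra.
Qed.

(** From some stage on each vertex stays in one sheet while its image tends to a grid point.
    Closedness of good sheets lifts the grid, and joined consecutive lifts form a set over the
    segment. *)
Lemma joined_of_chain K e p r N x : convex_in_dual K -> 0 < e ->
  (forall z, K (f z) -> good f z (2 * e)) -> admissible K e p r N x ->
  joined f p r.
Proof.
move=> convK e0 goodK adm0.
have [N0|N0] := posnP N.
  have [x0 xN _ _] := adm0; exists [set p]; split => //; first exact: connected1.
    by rewrite -xN N0 x0.
  by move=> _ ->; exact: segmentl.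
have /choice[step Hstep] : forall x, exists x', admissible K e p r N x ->
    [/\ admissible K e p r N x',
    forall i, (i.+1 < N)%N -> f (x' i.+1) = comb 2^-1 (f (x i)) (f (x i.+2))
    & forall i, (i <= N)%N -> sheet f (x i) e (x' i)].
  move=> y; have [/(shortening_step _ _ _ _ _ _ convK e0 goodK)[z Hz]|] :=
    pselect (admissible K e p r N y); first by exists z.
  by exists y.
pose s m := iter m step x.
have s_adm m : admissible K e p r N (s m).
  by elim: m => [//|m IH]; have [] := Hstep _ IH.
have s_mid m i : (i.+1 < N)%N -> f (s m.+1 i.+1) = comb 2^-1 (f (s m i)) (f (s m i.+2)).
  by have [_ + _] := Hstep _ (s_adm m); apply.
have s_sheet m i : (i <= N)%N -> sheet f (s m i) e (s m.+1 i).
  by have [_ _] := Hstep _ (s_adm m); apply.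
have sK m i : (i <= N)%N -> K (f (s m i)) by have [_ _ _] := s_adm m; apply.
have s0 m : s m 0%N = p by have [] := s_adm m.
have sN m : s m N = r by have [] := s_adm m.
pose g := grid (f p) (f r) N.
have gd i : dual (g i) by exact: dual_comb.
have cvg d : 0 < d -> exists m0, forall m i, (m0 <= m)%N -> (i <= N)%N ->
    dist (f (s m i)) (g i) < d.
  move=> d0; have [M M0 HM] := shortening_error p r N s N0 s0 sN s_mid.
  have NR : 1 <= N%:R :> R by rewrite ler1n.
  have N2 : 0 < N%:R ^+ 2 :> R by rewrite exprn_gt0//; lra.
  set q : R := 1 - (N%:R ^+ 2)^-1 in HM.
  have q0 : 0 <= q by rewrite subr_ge0 invf_le1// exprn_ege1.
  have q1 : `|q| < 1 by rewrite ger0_norm// /q ltrBlDr ltrDl invr_gt0.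
  have D0 : 0 < d / (1 + M * N%:R ^+ 2) by rewrite divr_gt0// ltr_pwDl// mulr_ge0// ltW.
  have /cvgr_dist_lt /(_ _ D0) [m0 _ Hm0] := cvg_expr q1.
  exists m0 => m i /Hm0 /=; rewrite sub0r normrN ger0_norm ?exprn_ge0// => qm iN.
  apply: le_lt_trans (HM m i iN) _.
  move: qm; rewrite ltr_pdivlMr ?ltr_pwDl ?mulr_ge0 ?(ltW N2)// => qm.
  have i0 : 0 <= i%:R :> R by rewrite ler0n.
  have i1 : i%:R <= N%:R :> R by rewrite ler_nat.
  have phi : i%:R * (N%:R - i%:R) <= N%:R ^+ 2 :> R by rewrite expr2; nra.
  have qm0 : 0 <= q ^+ m by rewrite exprn_ge0.
  apply: (@le_lt_trans _ _ (M * q ^+ m * N%:R ^+ 2)).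
    by rewrite ler_wpM2l// mulr_ge0.
  apply: le_lt_trans qm.
  have -> : q ^+ m * (1 + M * N%:R ^+ 2) = q ^+ m + M * q ^+ m * N%:R ^+ 2 by ring.
  by rewrite lerDr.
(* Two stages within [e / 4] of the grid are within [e / 2] of each other; a drift and one further
   step, both below [e / 2], fit in radius [e]. *)
have [m0 Hm0] := cvg (e / 4) ltac:(lra).
have goodKe z : K (f z) -> good f z e.
  by move/goodK => ?; apply: (good_le f fcont z (2 * e)) => //; lra.
have stay m i : (m0 <= m)%N -> (i <= N)%N -> sheet f (s m0 i) e (s m i).
  move=> + iN; elim: m => [|m IH].
    by rewrite leqn0 => /eqP ->; exact: sheet_refl.
  rewrite leq_eqVlt ltnS => /predU1P[<-|m0m]; first exact: sheet_refl.
  have A := Hm0 m i m0m iN; have B := Hm0 m.+1 i (leqW m0m) iN.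
  have C := Hm0 m0 i (leqnn _) iN.
  have T1 := dist_triangle (g i) (f (s m i)) (f (s m0 i)) (fd _) (gd i) (fd _).
  have T2 := dist_triangle (g i) (f (s m.+1 i)) (f (s m i)) (fd _) (gd i) (fd _).
  rewrite (distC (g i)) in T1; rewrite (distC (g i)) in T2.
  apply: (sheet_trans f fcont (s m i) (s m0 i) (s m.+1 i) e (e / 2)) => //; [exact: IH| |lra].
  apply: (good_sheet f fcont (s m i) e); [exact/goodKe/sK|exact: sheet_refl|exact: s_sheet|lra].
have lim i : (i <= N)%N -> exists2 y, sheet f (s m0 i) e y & f y = g i.
  move=> iN; have [_ _ closed_i] := goodKe _ (sK m0 i iN); apply: closed_i => //.
    by have := Hm0 m0 i (leqnn _) iN; rewrite distC; lra.
  move=> d /cvg [m1 Hm1]; exists (s (maxn m0 m1) i); first by apply: stay => //; exact: leq_maxl.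
  by apply: Hm1 => //; exact: leq_maxr.
have /choice[y Hy] : forall i, exists y, (i <= N)%N -> sheet f (s m0 i) e y /\ f y = g i.
  move=> i; have [/lim [y]|] := boolP (i <= N)%N; last by exists p.
  by exists y.
pose reach u := exists A : set X, [/\ connected A, A p, A u
  & forall z, A z -> segment (f p) (f r) (f z)].
(* A joining set between points over the segment lies over a subsegment, so it can be appended. *)
have reach_joined u w : reach u -> joined f u w -> segment (f p) (f r) (f u) ->
    segment (f p) (f r) (f w) -> reach w.
  move=> [A [cA Ap Au AS]] [B [cB Bu Bw BS]] [a a01 fu] [b b01 fw].
  exists (A `|` B); split; [by apply: connectedU => //; exists u|by left|by right|].
  move=> z [/AS //|/BS]; rewrite -fu -fw; apply: segment_segment.
    by move: a01; rewrite /= in_itv.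
  by move: b01; rewrite /= in_itv.
have reachp : reach p.
  by exists [set p]; split => //; [exact: connected1|move=> _ ->; exact: segmentl].
have g0 : g 0%N = f p by rewrite /g /grid mul0r comb0.
have gN : g N = f r by rewrite /g /grid divff ?comb1// pnatr_eq0 -lt0n.
have reachy i : (i <= N)%N -> reach (y i).
  elim: i => [|i IH] iN.
    have [y0 fy0] := Hy 0%N iN; apply: reach_joined reachp _ (segmentl _ _) _.
      have [_ j _] := goodKe _ (sK m0 0%N iN); apply: j => //.
      by rewrite s0; exact: sheet_refl.
    by rewrite fy0; exact: grid_segment.
  have [yi fyi] := Hy i (ltnW iN); have [yi1 fyi1] := Hy i.+1 iN.
  apply: reach_joined (IH (ltnW iN)) _ _ _; last 2 first.
  - by rewrite fyi; apply: grid_segment; exact: ltnW.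
  - by rewrite fyi1; exact: grid_segment.
  (* Both lifts lie in the sheet of radius [2 * e] around [s m0 i], the second by way of
     [s m0 i.+1]. *)
  have [_ j _] := goodK _ (sK m0 i (ltnW iN)); apply: j.
    by apply: (sheet_trans f fcont (s m0 i) (s m0 i) (y i) e e) => //;
      [exact: sheet_refl|lra|rewrite distxx//; lra].
  have [_ _ /(_ i iN) st _] := s_adm m0.
  apply: (sheet_trans f fcont (s m0 i.+1) (s m0 i) (y i.+1) e e) => //; first lra.
  by have := sheet_dist _ _ _ _ st; lra.
have [yN fyN] := Hy N (leqnn N).
apply: reach_joined (reachy N (leqnn N)) _ _ (segmentr _ _); last first.
  by rewrite fyN gN; exact: segmentr.
have [_ j _] := goodKe _ (sK m0 N (leqnn N)); apply: j => //.
by rewrite sN; exact: sheet_refl.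
Qed.

End CurveShortening.

(** * Connected fibers, openness and convexity of the image *)

Section Conclusion.
Context {R : realType} {W : completeNormedModType R} {X : topologicalType}.
Variable f : X -> (W -> R).
Hypotheses (fcont : ncontinuous f) (fclosed : wclosed_map f)
  (lcd : local_convexity_data f) (lfc : locally_fiber_connected f)
  (lcX : locally_connected_space X) (normX : normal_space X)
  (hausX : hausdorff_space X) (connX : connected [set: X]).

Let fd x : dual (f x) := fcont.1 x.
#[local] Hint Resolve fd : core.

Lemma joined_all p r : joined f p r.
Proof.
have [n [v [A [dv cA Ap Ar AK]]]] :=
  connected_zonotope f fcont fclosed lcd lfc lcX normX connX p r.
have [e e0 gK] := good_zonotope f fcont fclosed lcd lfc lcX normX hausX connX n v dv.
(* The chain uses half the radius, as shortening asks for good sheets of twice the link radius. *)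
have e20 : 0 < e / 2 by rewrite divr_gt0.
have ee : 2 * (e / 2) = e by field.
have gA x : A x -> good f x (e / 2).
  move=> /AK /gK; apply: good_le => //; lra.
have [N [x [x0 xN xs xA]]] := sheet_chain f fcont lcX A p r (e / 2) cA Ap Ar e20 gA.
apply: (joined_of_chain f fcont (zonotope n v) (e / 2) p r N x) => //.
- exact: zonotope_convex.
- by move=> z /gK; rewrite ee.
- by split => // i /xA /AK.
Qed.

(** With equal images the segment degenerates and the joining set lies in the fiber. *)
Lemma fiber_fcomp x y : f y = f x -> fcomp f x y.
Proof.
move=> yx; have [A [cA Ax Ay AS]] := joined_all x y; exists A => //; split => // z /AS.
by rewrite yx => -[t _ fz]; rewrite /= -fz combxx.
Qed.

Lemma fiber_connected v : connected (f @^-1` [set v]).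
Proof.
have [[x fx]|nx] := pselect (exists x, f x = v); last first.
  suff -> : f @^-1` [set v] = set0 by exact: connected0.
  by apply/seteqP; split => // x fx; apply: nx; exists x.
suff -> : f @^-1` [set v] = fcomp f x by exact: component_connected.
apply/seteqP; split => y; last by move/fcomp_eq => /= ->.
by rewrite /= -fx; exact: fiber_fcomp.
Qed.

(** Connected fibers let [nbhs_sat] carry a chart inside [O] to any other point of the same
    fiber. *)
Lemma open_saturation (O : set X) : open O -> open (f @^-1` (f @` O)).
Proof.
move=> oO; rewrite openE => x [o Oo ox].
have [U [C [chU Uo UO]]] := exists_chart f o O lcd lfc (open_nbhs_nbhs (conj oO Oo)).
have xo : fcomp f o x by exact: fiber_fcomp.
apply: filterS (nbhs_sat f U C o x fcont lcd lfc chU Uo xo) => y [a Ua ay].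
by exists a; [exact: UO|rewrite (fcomp_eq _ _ _ ay)].
Qed.

Lemma open_onto_image : wopen_onto_image f.
Proof.
move=> O oO; have [_ oG] := fclosed _ (open_closedC (open_saturation O oO)).
(* The complement of the saturation is closed, so its image is weak-star closed; that image and the
   image of [O] partition the range. *)
exists (dual `\` f @` (~` (f @^-1` (f @` O)))); split => //.
apply/seteqP; split => [_ [x Ox <-]|v [[_ nZ] [x _ fx]]].
  by split; [split => // -[y ny xy]; apply: ny; exists x|exists x].
by apply: contrapT => nO; apply: nZ; exists x => //=; rewrite fx.
Qed.

Lemma eval_continuous w : continuous (fun x => f x w).
Proof.
move=> x; apply/cvgrPdist_lt => e e0.
have d0 : 0 < e / (1 + `|w|) by rewrite divr_gt0// ltr_pwDl.
have : nbhs x (preball f (f x) (e / (1 + `|w|))).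
  by apply: nbhs_preball => //; rewrite distxx.
apply: filterS => y; rewrite /preball /= ltr_pdivlMr ?ltr_pwDl// => yx.
apply: le_lt_trans yx; rewrite distrC.
apply: le_trans (le_dist_norm _ _ _ (fd y) (fd x)) _.
by rewrite ler_wpM2l// ?dist_ge0// lerDr.
Qed.

(** Evaluation at a [w] separating the end images is injective on their segment and maps the
    connected [A] onto an interval, so every point of the segment is attained. *)
Lemma range_convex : convex_in_dual (range f).
Proof.
move=> _ _ t [p _ <-] [r _ <-] t01.
have [A [cA Ap Ar AS]] := joined_all p r.
have [fpr|fpr] := pselect (f p = f r).
  by rewrite fpr combxx; exists r.
have [w fw] : exists w, f p w <> f r w.
  by apply: contrapT => H; apply: fpr; apply/funext => w; apply: contrapT => ?; apply: H; exists w.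
have /connected_intervalP itv : connected [set f x w | x in A].
  apply: (connected_continuous_connected cA).
  exact/continuous_subspaceT/eval_continuous.
have [x Ax fx] : [set f x w | x in A] (comb t (f p) (f r) w).
  have [lt|gt|/fw//] := ltgtP (f p w) (f r w).
    apply: (itv (f p w) (f r w)); [by exists p|by exists r|].
    by rewrite /comb; apply/andP; split; nra.
  apply: (itv (f r w) (f p w)); [by exists r|by exists p|].
  by rewrite /comb; apply/andP; split; nra.
exists x => //; have [s _ fs] := AS x Ax.
move: fx; rewrite -fs /comb => E; suff -> : t = s by [].
apply/eqP; rewrite -subr_eq0; apply/eqP; have /eqP : (t - s) * (f p w - f r w) = 0.
  by move: E => /eqP; rewrite -subr_eq0 => /eqP <-; ring.
by rewrite mulf_eq0 [X in _ || X]subr_eq0 => /orP[/eqP//|/eqP].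
Qed.

End Conclusion.

Theorem theorem2p30 (R : realType) (W : completeNormedModType R)
  (X : topologicalType) (f : X -> (W -> R)) :
  connected [set: X] ->
  locally_connected_space X ->
  hausdorff_space X ->
  first_countable_space X ->
  normal_space X ->
  ncontinuous f ->
  local_convexity_data f ->
  locally_fiber_connected f ->
  wclosed_map f ->
  [/\ (forall v : W -> R, connected (f @^-1` [set v])),
      wopen_onto_image f
    & wclosed (range f) /\ convex_in_dual (range f)].
Proof.
move=> connX lcX hausX _ normX fcont lcd lfc fclosed.
split; [|exact: open_onto_image|split].
- exact: fiber_connected.
- exact: fclosed closedT.
- exact: range_convex.
Qed.
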